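(* There exists a strongly zero-dimensional Abelian topological group $G$ containing a closed subgroup $H$ with $\dim_0(H)>0$.
   Context: For a topological space $X$, a cozero set is a set of the form $\{x\in X: f(x)\neq 0\}$ with $f\colon X\to\mathbb{R}$ continuous, and a cozero cover is a cover by cozero sets. $\dim_0 X$ is the least integer $n\ge -1$ such that any finite cozero cover of $X$ has a finite cozero refinement of order $n$, provided that such an $n$ exists (a cover has order at most $n$ if every point belongs to at most $n+1$ of its elements); if no such $n$ exists, then $\dim_0 X=\infty$. A space $X$ is strongly zero-dimensional if $\dim_0 X=0$. The subgroup $H$ carries the subspace topology. *)

(* Defs.v *)
From HB Require Import structures.
From mathcomp Require Import all_boot all_order all_algebra.
From mathcomp Require Import zify.
From mathcomp Require Import all_classical all_reals all_analysis.
Set Implicit Arguments.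
Unset Strict Implicit.
Unset Printing Implicit Defensive.
Import Order.TTheory GRing.Theory Num.Theory.
Import numFieldNormedType.Exports.
Local Open Scope classical_set_scope.
Local Open Scope ring_scope.
Local Open Scope card_scope.

Definition cozero (R : realType) (X : topologicalType) (A : set X) : Prop :=
  exists2 f : X -> R, continuous f & A = [set x | f x != 0].

Definition finite_cozero_cover (R : realType) (X : topologicalType)
    (U : set (set X)) : Prop :=
  [/\ finite_set U, (forall A, U A -> cozero R A) & cover U id = setT].

Definition refines (X : Type) (V U : set (set X)) : Prop :=
  forall B, V B -> exists2 A, U A & B `<=` A.

(* Meaningful for n >= -1 only, where the natural number absz (n + 1) is n + 1. *)
Definition order_le (X : Type) (V : set (set X)) (n : int) : Prop :=
  forall x : X, [set B | V B /\ B x] #<= `I_(absz (n + 1)%R).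

Definition dim0_le (R : realType) (X : topologicalType) (n : int) : Prop :=
  forall U : set (set X), finite_cozero_cover R U ->
  exists V : set (set X),
    [/\ finite_cozero_cover R V, refines V U & order_le V n].

(* The image set has at most one element; it is empty, and the value is +oo,
   exactly when dim0_le fails for every n >= -1. *)
Definition dim0 (R : realType) (X : topologicalType) : \bar int :=
  xget +oo%E (EFin @` [set n : int | [/\ -1 <= n, dim0_le R X n &
    forall m : int, -1 <= m -> dim0_le R X m -> n <= m]]).

Definition strongly_zero_dimensional (R : realType) (X : topologicalType) :
  Prop := dim0 R X = 0%:E.

Lemma dim0_le_mono (R : realType) (X : topologicalType) (m n : int) :
  -1 <= m -> m <= n -> dim0_le R X m -> dim0_le R X n.
Proof.
move=> m1 mn Hm U /Hm[V [cV rV oV]]; exists V; split => // x.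
by apply: (card_le_trans (oV x)); rewrite card_le_II; lia.
Qed.

Lemma dim0_leP (R : realType) (X : topologicalType) (n : int) :
  -1 <= n -> (dim0 R X <= n%:E)%E <-> dim0_le R X n.
Proof.
move=> n1; rewrite /dim0; case: xgetP => [d -> [k [k1 Hk mink] <-]|none].
  by rewrite lee_fin; split=> [kn|]; [exact: dim0_le_mono Hk|exact: mink].
split=> // Hn; exfalso.
have ex : exists k : nat, `[< dim0_le R X (k%:Z - 1) >].
  by exists (absz (n + 1)); apply/asboolP; rewrite (_ : _ - 1 = n) //; lia.
case: (ex_minnP ex) => k /asboolP Hk mink.
apply: (none (k%:Z - 1)%:E); exists (k%:Z - 1) => //; split=> // [|m m1 Hm].
  by lia.
suff /asboolP/mink : dim0_le R X ((absz (m + 1))%:Z - 1) by lia.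
by rewrite (_ : _ - 1 = m) //; lia.
Qed.

(* Main.v *)
From HB Require Import structures.
Require Import Defs.
From mathcomp Require Import all_boot all_order all_algebra.
From mathcomp Require Import zify.
From mathcomp Require Import all_classical all_reals all_analysis.
Import GRing.Theory Num.Theory.
Import Order.TTheory numFieldNormedType.Exports.
Set Implicit Arguments.
Unset Strict Implicit.
Unset Printing Implicit Defensive.
Local Open Scope classical_set_scope.
Local Open Scope ring_scope.

(** Three ideas carry the proof.

    Large groups of functions are strongly zero-dimensional. Let [D] be a
    countable discrete group and let [S] be a subgroup of [D ^ L] that contains
    all functions with countable support. Countably many continuous real
    functions on [S] depend on a countable set [J] of coordinates
    ([depends_on_countably_many]). A finite cozero cover of [S] therefore comes
    from [D ^ J], and there each point can be sent to a member of the cover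
    containing the largest initial cylinder around it that fits into one
    ([sigma_product_strongly_zero_dimensional]).

    Every subgroup [H] of [D ^ I] is a closed subgroup of such an [S]. Take
    [L = O * I] with [O] uncountable, and let [S] consist of the functions that
    agree off a countable set with [(o, i) |-> h i] for some [h] in [H]. Those
    elements of [S] that do not depend on [o] form a closed subgroup, and they
    are exactly the copies of elements of [H], because countably many
    exceptions miss some [o] entirely ([diagonalE]).

    It remains to find a group [H] of this form with positive dimension. Let
    [X] be the following variant of the Mrowka-Isbell spaces. Its isolated
    points are the pairs of a node of the binary tree and a rational number; its
    other points are the branches [p] of the tree, where a neighbourhood of [p]
    contains the pairs [(p|n, r)] with [n] large and [r] close to a real number
    [t_p]. The function with value [r] at a pair and [t_p] at a branch is
    continuous. Read as a 0-1 sequence, a branch codes a set [U] of isolated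
    points, and [t_p] is chosen so that [p] lies in the closure of [U] and of
    its complement whenever [U] separates the values at most 0 from the values
    at least 1 ([splits_ex]). Hence no clopen subset of [X] separates these
    values. Now [H] is the free Boolean group on [X] with the topology given by
    all continuous maps from [X] to the discrete space of natural numbers.

    The crux is that the function on [X] extends to a continuous function on
    [H], although it is far from uniformly continuous there
    ([selected_value_continuous]). An element of [H] is a finite set of points
    up to parity. Walk down the binary tree, going to the right child exactly
    when an odd number of points lies above it, and stop at the first node that
    carries a pair of odd multiplicity: the value is the rational of that pair,
    or [t_p] if the walk never stops and traces the branch [p]. In the second
    case a single colouring ([guide]) fixes the parities in all the cones that
    leave [p]. The walk of a nearby element thus cannot leave [p]; it either
    follows [p] for ever or stops at a pair close to [p]. *)

(** * Groups of functions with the topology of pointwise convergence *)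

(** A new name for the subtype keeps this topology apart from the ones that
    function types and subtypes may carry. *)
Definition pointwise_group (L : eqType) (D : zmodType)
  (S : zmodClosed (L -> D)) := {u : L -> D | u \in S}.

Section PointwiseGroup.
Context (L : eqType) (D : zmodType) (S : zmodClosed (L -> D)).
Local Notation G := (pointwise_group S).

HB.instance Definition _ := Choice.on G.
HB.instance Definition _ := SubType.on G.
HB.instance Definition _ := [SubChoice_isSubZmodule of G by <:].

Definition agree_on (l : seq L) (u v : G) := {in l, val u =1 val v}.

Lemma agree_on_cat (l1 l2 : seq L) (u v : G) :
  agree_on (l1 ++ l2) u v <-> agree_on l1 u v /\ agree_on l2 u v.
Proof.
split=> [h|[h1 h2] i]; first by split=> i il; apply: h; rewrite mem_cat il ?orbT.
by rewrite mem_cat => /orP[/h1|/h2].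
Qed.

HB.instance Definition _ := hasNbhs.Build G
  (fun u => [set A | exists l : seq L, [set v | agree_on l u v] `<=` A]).

Lemma pointwise_nbhs_filter (u : G) : ProperFilter (nbhs u).
Proof.
split; first by move=> [l]; apply; apply: (_ : agree_on l u u).
split; first by exists [::].
  move=> A B [l1 h1] [l2 h2]; exists (l1 ++ l2) => v /agree_on_cat[/h1 ? /h2 ?].
  by split.
by move=> A B AB [l h]; exists l => v /h/AB.
Qed.

Lemma pointwise_nbhs_singleton (u : G) (A : set G) : nbhs u A -> A u.
Proof. by move=> [l]; apply; apply: (_ : agree_on l u u). Qed.

Lemma pointwise_nbhs_nbhs (u : G) (A : set G) :
  nbhs u A -> nbhs u (nbhs^~ A).
Proof.
move=> [l h]; exists l => v uv; exists l => w vw; apply: h => i il.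
by rewrite uv// vw.
Qed.

HB.instance Definition _ := Nbhs_isNbhsTopological.Build G
  pointwise_nbhs_filter pointwise_nbhs_singleton pointwise_nbhs_nbhs.

Lemma pointwise_sub_continuous : continuous (fun x : G * G => x.1 - x.2).
Proof.
move=> [u v] A [l h] /=.
exists ([set w | agree_on l u w], [set w | agree_on l v w]).
  by split; exists l.
move=> [u' v'] [/= uu' vv']; apply: h => i il.
rewrite !raddfB /=; change (val u i - val v i = val u' i - val v' i).
by rewrite uu'// vv'.
Qed.

HB.instance Definition _ :=
  PreTopologicalNmodule_isTopologicalZmodule.Build G pointwise_sub_continuous.

End PointwiseGroup.

(** * Continuous functions depend on countably many coordinates *)

(** The sequence is the union of [j_0, j_1, ...], where [j_(n+1)] enumerates
    [j_n] together with all entries of all [F a t] with [a] over [j_n]. Each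
    finite list over the union is a list over some [j_n]. *)
Lemma countable_closure (L : eqType) (D T : countType) (l0 : L)
    (F : seq (L * D) -> T -> seq L) :
  exists j : nat -> L, forall a t,
    (forall x, x \in a -> range j x.1) -> forall l, l \in F a t -> range j l.
Proof.
pose step (j : nat -> L) (k : nat) : L :=
  match unpickle k : option (nat + (seq (nat * D) * T * nat)) with
  | Some (inl k') => j k'
  | Some (inr (b, t, n)) => nth l0 (F [seq (j x.1, x.2) | x <- b] t) n
  | None => l0
  end.
pose js n := iter n step (fun=> l0).
have jsS n l : range (js n) l -> range (js n.+1) l.
  move=> [k _ <-].
  exists (pickle (inl k : nat + (seq (nat * D) * T * nat))) => //=.
  by rewrite /step pickleK.
have jsD m n l : range (js n) l -> range (js (m + n)%N) l.
  by elim: m => [//|m IH] /IH; exact: jsS.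
pose j k := if unpickle k is Some (n, k') then js n k' else l0.
have jsj n l : range (js n) l -> range j l.
  by move=> [k _ <-]; exists (pickle (n, k)) => //; rewrite /j pickleK.
exists j => a t aj l la.
have [n [b ab]] : exists n b, a = [seq (js n x.1, x.2) | x <- b].
  elim: a aj {la} => [|[i d] a IH] aj; first by exists 0%N, [::].
  have [|n [b ->]] := IH; first by move=> x xa; apply: aj; rewrite inE xa orbT.
  have [k _ /= ki] := aj _ (mem_head _ _).
  have [m mi] : exists m, range (js m) i.
    move: ki; rewrite /j; case: unpickle => [[m k']|] <-; first by exists m, k'.
    by exists 0%N, 0%N.
  have [k1 _ k1i] := jsD n m i mi.
  have up : forall y, exists q, js (n + m)%N q = js n y.
    move=> y; have := jsD m n (js n y); rewrite addnC => -[|q _ <-]; first by exists y.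
    by exists q.
  have [h hE] := choice up.
  exists (n + m)%N, ((k1, d) :: [seq (h x.1, x.2) | x <- b]).
  by rewrite /= k1i -map_comp; congr cons; apply: eq_map => x /=; rewrite hE.
apply: (jsj n.+1); move: la; rewrite ab => la.
exists (pickle (inr (b, t, index l (F a t)) : nat + (seq (nat * D) * T * nat))) => //=.
by rewrite /step pickleK ab nth_index.
Qed.

Definition contains_sigma_product (L : eqType) (D : zmodType)
    (S : zmodClosed (L -> D)) :=
  forall (j : nat -> L) (u : L -> D), (forall l, ~ range j l -> u l = 0) -> u \in S.

(** Call a finite list [l] good for a finite partial function [a] and a rational
    [t] if [f i < t] on the set of all [w] that agree on [l] with one fixed
    extension [v] of [a]. Let [j] enumerate a set of coordinates closed under
    picking a good list. If [u] and [v] agree on [j] and [f i v < t < f i u],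
    let [a] be the restriction of [u] to the coordinates in [j] that matter for
    [t < f i u]. The list picked for [a] is good because of [v], and it stays
    inside [j]; so it is compatible with the neighbourhood of [u], and a point
    in both neighbourhoods is contradictory. *)
Lemma depends_on_countably_many (R : realType) (L : choiceType)
    (D : countZmodType) (S : zmodClosed (L -> D))
    (f : nat -> pointwise_group S -> R) (l0 : L) :
  contains_sigma_product S -> (forall i, continuous (f i)) ->
  exists j : nat -> L, forall i (u v : pointwise_group S),
    (forall l, range j l -> val u l = val v l) -> f i u = f i v.
Proof.
move=> sigmaS cf.
pose good (a : seq (L * D)) (t : rat * nat) := [set l : seq L |
  exists v : pointwise_group S, (forall x, x \in a -> val v x.1 = x.2) /\
    forall w, agree_on l v w -> f t.2 w < ratr t.1].
have [j jP] := countable_closure l0 (fun a t => xget [::] (good a t)).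
exists j => i.
suff le u v : (forall l, range j l -> val u l = val v l) -> f i u <= f i v.
  by move=> u v uv; apply/eqP; rewrite eq_le !le// => l /uv.
move=> uv; rewrite leNgt; apply/negP => fuv.
have [r /andP[vr ru]] : exists r, f i v < ratr r < f i u.
  by have [r] := rat_in_itvoo fuv; rewrite in_itv /=; exists r.
have [lu hu] : nbhs u [set w | ratr r < f i w].
  exact: (cf i u _ (lt_nbhsr ru)).
have [lv hv] : nbhs v [set w | f i w < ratr r].
  exact: (cf i v _ (lt_nbhsl vr)).
(* [v] equals [u] on these coordinates. *)
pose a := [seq (l, val v l) | l <- lu & `[< range j l >]].
have /xgetPex /= : exists l, good a (r, i) l.
  by exists lv, v; split => // x /mapP[l _ ->].
move/(_ [::]); set l' := xget _ _ => -[v' [v'a hv']].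
have l'j : forall l, l \in l' -> range j l.
  apply: jP => x /mapP[l]; rewrite mem_filter => /andP[/asboolP jl _] ->.
  exact: jl.
(* Finite support makes this common point an element of the group. *)
pose w l := if l \in l' then val v' l else if l \in lu then val u l else 0.
have wS : w \in S.
  apply: (sigmaS (nth l0 (l' ++ lu))) => l nl; rewrite /w.
  have : l \notin l' ++ lu.
    by apply/negP => ll; apply: nl; exists (index l (l' ++ lu)) => //; exact: nth_index.
  by rewrite mem_cat negb_or => /andP[/negbTE -> /negbTE ->].
have wr : f i (Sub w wS) < ratr r.
  by apply: hv' => l ll'; rewrite SubK /w ll'.
suff : ratr r < f i (Sub w wS) by move/(lt_trans wr); rewrite ltxx.
apply: hu => l llu; rewrite SubK /w; case: ifP => ll'; last by rewrite llu.
have jl := l'j _ ll'; rewrite uv//.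
apply/esym/(v'a (l, val v l)); apply/mapP; exists l => //.
by rewrite mem_filter llu andbT; apply/asboolP.
Qed.

(** * Dimension at most zero and clopen sets *)

(** The level sets of the locally constant choice [a] are a clopen partition
    that refines the cover. *)
Lemma dim0_le0_of_selection (R : realType) (X : topologicalType) :
  (forall U, finite_cozero_cover R U -> exists a : X -> set X, forall x,
     [/\ U (a x), a x x & \forall y \near x, a y = a x]) ->
  dim0_le R X 0.
Proof.
move=> sel U Ucover; have [a aP] := sel U Ucover.
have [finU _ _] := Ucover.
exists [set [set x | a x = A] | A in U]; split; first split.
- exact: finite_image.
- move=> _ [A _ <-]; exists (fun x => if `[< a x = A >] then 1 else 0).
    move=> x; apply: cvg_near_cst; have [_ _] := aP x.
    by apply: filterS => y ->.
  by apply/seteqP; split=> x /=; case: asboolP; rewrite ?oner_eq0 ?eqxx.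
- apply/seteqP; split=> // x _; exists [set y | a y = a x] => //.
  by exists (a x) => //; have [] := aP x.
- move=> _ [A UA <-]; exists A => // x /= xA.
  by have [_ + _] := aP x; rewrite xA.
- move=> x; apply: (@card_le_trans _ _ _ [set [set y | a y = a x]]).
    by apply: subset_card_le => _ [[A _ <-] /= ->].
  by have /card_eqPle[] := @card_set1 (set X) [set y | a y = a x].
Qed.

Lemma strongly_zero_dimensional_of_dim0_le0 (R : realType) (X : topologicalType) (x : X) :
  dim0_le R X 0 -> strongly_zero_dimensional R X.
Proof.
move=> le0; have U0 : finite_cozero_cover R [set [set: X]].
  split; first exact: finite_set1.
    move=> A ->; exists (cst 1); first exact: cst_continuous.
    by apply/seteqP; split=> y //= _; exact: oner_neq0.
  by rewrite /cover bigcup_set1.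
have Nle1 n : -1 <= n -> dim0_le R X n -> 0 <= n.
  move=> n1 /(_ _ U0)[V [[_ _ cV] _ oV]]; rewrite leNgt; apply/negP => n0.
  have nE : n = -1 by apply/eqP; rewrite eq_le n1 andbT -ltzD1.
  have [B VB Bx] : cover V id x by rewrite cV.
  by have := oV x; rewrite nE II0 card_le0 => /eqP/seteqP[/(_ B)/(_ (conj VB Bx))].
rewrite /strongly_zero_dimensional /dim0; apply: xget_unique.
  by exists 0 => //; split.
move=> _ [n [n1 lenX minn] <-]; congr EFin; apply/eqP.
by rewrite eq_le minn//= Nle1.
Qed.

(** A cozero refinement of order 0 of the cover by [f < 1] and [f > 0] is a
    partition into open sets; its members inside [f < 1] make up [W]. *)
Lemma clopen_separation_of_dim0_le0 (R : realType) (X : topologicalType)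
    (f : X -> R) : dim0_le R X 0 -> continuous f ->
  exists W : set X, [/\ open W, open (~` W),
    [set x | f x <= 0] `<=` W & [set x | 1 <= f x] `<=` ~` W].
Proof.
move=> le0 cf; pose A0 := [set x | f x < 1]; pose A1 := [set x | 0 < f x].
have cz (g : X -> R) : continuous g -> cozero R [set x | 0 < g x].
  move=> cg; exists (fun x => Num.max (g x) 0).
    by move=> x; apply: continuous_max; [exact: cg|exact: cst_continuous].
  apply/seteqP; split=> x /=; first by move=> gx; rewrite max_l ?gt_eqF// ltW.
  by case: (ltP 0 (g x)) => // g0; rewrite eqxx.
have [V [[_ cV covV] refV ordV]] : exists V, [/\ finite_cozero_cover R V,
    refines V [set A0; A1] & order_le V 0].
  apply: le0; split; first exact: finite_set2.
    move=> A [] ->; last exact: cz.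
    rewrite (_ : A0 = [set x | 0 < 1 - f x]).
      by apply: cz => x; apply: cvgB; [exact: cvg_cst|exact: cf].
    by apply/seteqP; split=> x /=; rewrite subr_gt0.
  apply/seteqP; split=> // x _; have [fx|fx] := ltP (f x) 1.
    by exists A0 => //; left.
  by exists A1; [right|rewrite /A1/=; exact: lt_le_trans fx].
have oV B : V B -> open B.
  move=> /cV[g cg ->]; apply: (open_comp (f := g) (D := [set y | y != 0])).
    by move=> x _; exact: cg.
  exact: open_neq.
have uniqV B C x : V B -> V C -> B x -> C x -> B = C.
  move=> VB VC Bx Cx; have := ordV x; rewrite add0r /= => le1.
  have /pcard_leP[g] := le1.
  have gE D : V D -> D x -> g D = 0%N.
    by move=> VD Dx; have /= := @funS _ _ _ _ g D (conj VD Dx); case: (g D).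
  apply: (@inj _ _ _ g B C); rewrite ?inE//.
  exact: etrans (gE B VB Bx) (esym (gE C VC Cx)).
pose W := \bigcup_(B in [set B | V B /\ B `<=` A0]) B.
have WC : ~` W = \bigcup_(B in [set B | V B /\ ~ B `<=` A0]) B.
  apply/seteqP; split=> x /=.
    move=> nW; have [B VB Bx] : cover V id x by rewrite covV.
    by exists B => //; split=> // BA0; apply: nW; exists B.
  by move=> [B [VB nB] Bx] [C [VC CA0] Cx]; apply: nB; rewrite (uniqV B C x).
exists W; split.
- by apply: bigcup_open => B [/oV].
- by rewrite WC; apply: bigcup_open => B [/oV].
- move=> x /= fx; apply: contrapT => nWx.
  have [B [VB nB] Bx] : (\bigcup_(B in [set B | V B /\ ~ B `<=` A0]) B) x.
    by rewrite -WC.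
  have [A [] AE BA] := refV _ VB; first by apply: nB; rewrite -AE.
  by have := BA _ Bx; rewrite AE /A1 /= ltNge fx.
- move=> x /= fx [B [VB BA0] Bx]; have := BA0 _ Bx.
  by rewrite /A0 /= ltNge fx.
Qed.

(** * Groups above a sigma-product are strongly zero-dimensional *)

(** The cylinders on the first [n] of countably many relevant coordinates are
    nested. The least [n] for which the cylinder around [u] lies in a member of
    the cover, and a chosen such member, depend only on that cylinder and hence
    are locally constant in [u]. *)
Lemma sigma_product_strongly_zero_dimensional (R : realType) (L : choiceType)
    (D : countZmodType) (S : zmodClosed (L -> D)) (l0 : L) :
  contains_sigma_product S -> strongly_zero_dimensional R (pointwise_group S).
Proof.
move=> sigmaS; apply: (strongly_zero_dimensional_of_dim0_le0 0).
apply: dim0_le0_of_selection => U [/finite_seqP[s sU] czU covU].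
have /choice[f fP] i : exists g : pointwise_group S -> R,
    continuous g /\ nth set0 s i = [set u | g u != 0].
  have [si|si] := ltnP i (size s).
    have [|g cg gE] := czU (nth set0 s i); first by rewrite sU; exact: mem_nth.
    by exists g.
  exists (cst 0); split; first exact: cst_continuous.
  by rewrite nth_default//; apply/seteqP; split=> u //=; rewrite eqxx.
have [j jP] := depends_on_countably_many l0 sigmaS (fun i => (fP i).1).
pose cyl (u : pointwise_group S) n := [set v : pointwise_group S |
  forall k, (k < n)%N -> val u (j k) = val v (j k)].
pose inside u n := [set A | U A /\ cyl u n `<=` A].
(* Replacing irrelevant coordinates by 0 does not change the values [f i], and
   turns neighbourhoods into cylinders on relevant coordinates. *)
pose cutf (u : pointwise_group S) l := if `[< range j l >] then val u l else 0.
have cutS u : cutf u \in S.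
  by apply: (sigmaS j) => l nl; rewrite /cutf; case: asboolP.
pose cut u : pointwise_group S := Sub (cutf u) (cutS u).
have fcut i u : f i (cut u) = f i u.
  by apply: jP => l jl; rewrite SubK /cutf; case: asboolP.
have ex u : exists n, inside u n !=set0.
  have [A UA Au] : cover U id u by rewrite covU.
  pose i := index A s.
  have AE : A = [set v | f i v != 0].
    by rewrite -(fP i).2 nth_index//; rewrite sU in UA.
  have [l hl] : nbhs (cut u) [set v | f i v != 0].
    apply: open_nbhs_nbhs; split; last by rewrite /= fcut; rewrite AE in Au.
    apply: (open_comp (f := f i) (D := [set y | y != 0])); last exact: open_neq.
    by move=> v _; exact: (fP i).1.
  have [n hn] : exists n, forall x, x \in l -> range j x ->
      exists2 k, (k < n)%N & j k = x.
    elim: l {hl} => [|x l [n IH]]; first by exists 0%N.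
    have [[k _ kx]|nx] := pselect (range j x).
      exists (maxn n k.+1) => y; rewrite inE => /predU1P[-> _|yl /(IH _ yl)[m mn my]].
        by exists k => //; rewrite leq_max ltnSn orbT.
      by exists m => //; rewrite leq_max mn.
    by exists n => y; rewrite inE => /predU1P[-> //|]; exact: IH.
  exists n, A; split=> // v uv; rewrite AE /= -fcut; apply: hl => x xl.
  rewrite !SubK /cutf; case: asboolP => // jx.
  by have [k kn <-] := hn x xl jx; exact: uv.
have /choice[N NP] u : exists n, inside u n !=set0 /\
    forall m, inside u m !=set0 -> (n <= m)%N.
  have exb : exists n, `[< inside u n !=set0 >].
    by have [n ?] := ex u; exists n; apply/asboolP.
  case: (ex_minnP exb) => n /asboolP nP minn.
  by exists n; split=> // m mP; apply/minn/asboolP.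
have insideE u v n : (n <= N u)%N -> cyl u (N u) v -> inside v n = inside u n.
  move=> nN uv; rewrite /inside (_ : cyl v n = cyl u n)//.
  by apply/seteqP; split=> w h k kn; rewrite -h// uv// (leq_trans kn).
have NE u v : cyl u (N u) v -> N v = N u.
  move=> uv; have Nvu : (N v <= N u)%N.
    by apply: (NP v).2; rewrite (insideE u)//; exact: (NP u).1.
  apply/eqP; rewrite eqn_leq Nvu; apply: (NP u).2.
  by rewrite -(insideE u v)//; exact: (NP v).1.
exists (fun u => xget set0 (inside u (N u))) => u.
have [Ua ua] := xgetPex set0 (NP u).1; split => //; first exact: ua.
exists [seq j k | k <- iota 0 (N u)] => v uv.
have {}uv : cyl u (N u) v.
  by move=> k kN; apply: uv; apply: map_f; rewrite mem_iota.
by rewrite /= (NE u)// (insideE u).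
Qed.

(** * The binary tree *)

Definition branch := nat -> bool.

(** Pairs of a node and a rational are the isolated points of [X]. *)
Definition tree_point := ((seq bool * rat) + branch)%type.

Definition trunc (x : tree_point) (n : nat) : seq bool :=
  match x with inl q => take n q.1 | inr p => mkseq p n end.

Definition cone (a : seq bool) (x : tree_point) : bool := trunc x (size a) == a.

Definition line (a : seq bool) (x : tree_point) : bool :=
  if x is inl q then q.1 == a else false.

Lemma take_mkseq (p : branch) (m n : nat) : (m <= n)%N ->
  take m (mkseq p n) = mkseq p m.
Proof. by move=> mn; rewrite /mkseq -map_take take_iota (minn_idPl mn). Qed.

Lemma take_trunc (x : tree_point) (m n : nat) : (m <= n)%N ->
  take m (trunc x n) = trunc x m.
Proof. by case: x => [q|p] mn; [exact: take_takel|exact: take_mkseq]. Qed.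

Lemma cone_count_split (a : seq bool) (s : seq tree_point) :
  count (cone a) s = (count (line a) s +
    (count (cone (rcons a true)) s + count (cone (rcons a false)) s))%N.
Proof.
elim: s => //= x s ->.
suff -> : cone a x = (line a x + (cone (rcons a true) x + cone (rcons a false) x))%N
  :> nat by lia.
rewrite /cone !size_rcons; case: x => [[c r]|p] /=; last first.
  by rewrite mkseqS !eqseq_rcons; case: eqP; case: (p _).
have [ca|ac] := leqP (size c) (size a).
  rewrite !take_oversize//; last exact: leqW.
  have N b : (c == rcons a b) = false.
    by apply/negbTE/eqP => cE; move: ca; rewrite cE size_rcons ltnn.
  by rewrite !N !addn0.
rewrite (take_nth false ac) !eqseq_rcons.
have -> : (c == a) = false by apply/negbTE/eqP => ca; rewrite ca ltnn in ac.
by case: eqP; case: nth.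
Qed.

Lemma odd_count_ex (T : eqType) (a : pred T) (s : seq T) :
  odd (count a s) -> exists2 x, a x & odd (count_mem x s).
Proof.
move/permP: (perm_count_undup s) => /(_ a); rewrite count_flatten -map_comp => <- odds.
have /hasP[x _] : has (fun x => odd (a x * count_mem x s)) (undup s).
  elim: (undup s) odds => //= x l IH; rewrite oddD count_nseq.
  by case: odd => //=; exact: IH.
by rewrite oddM => /andP[ax cx]; exists x; first by case: (a x) ax.
Qed.

(** * Colourings and the free Boolean group *)

Section Construction.
Context (R : realType).

(** The branch [p] plays two roles: it is a branch of the tree, and the
    characteristic function of a set of pairs. With limit value [t], the point
    [p] lies in the closure of this set and of its complement. *)
Definition splits (p : branch) (t : R) := forall (m : nat) (b : bool),
  exists n r, [/\ (m <= n)%N, `|ratr r - t| < m.+1%:R^-1 &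
    p (pickle (mkseq p n, r)) = b].

Definition limit_value (p : branch) : R := xget 0 [set t | splits p t].

Definition branch_nbhs (p : branch) (m : nat) : set tree_point := [set x | x = inr p \/
  exists n r, [/\ x = inl (mkseq p n, r), (m <= n)%N &
    `|ratr r - limit_value p| < m.+1%:R^-1]].

Definition colouring := tree_point -> nat.

(** The continuous maps from [X] to the discrete space of natural numbers. *)
Definition admissible (c : colouring) := forall p : branch, exists m : nat,
  forall x, branch_nbhs p m x -> c x = c (inr p).

(** The image in [{poly bool}] of the word [s] of the free Boolean group on [X]
    under the homomorphism induced by [c]: the coefficient of degree [k] is the
    parity of the colour class [k]. The target is a countable group, which
    serves as the discrete group [D]. Other maps [c] are sent to 0, so that
    all maps can index the coordinates. *)
Definition colour_sum (s : seq tree_point) (c : colouring) : {poly bool} :=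
  if `[< admissible c >] then \sum_(x <- s) 'X^(c x) else 0.

Lemma coef_colour_sum (s : seq tree_point) (c : colouring) (k : nat) :
  admissible c -> (colour_sum s c)`_k = odd (count (fun x => c x == k) s).
Proof.
move=> cP; rewrite /colour_sum asboolT//.
elim: s => [|x s IH]; first by rewrite big_nil coef0.
by rewrite big_cons coefD coefXn IH /= oddD eq_sym; case: eqP; case: odd.
Qed.

Lemma colour_sum_cat (s1 s2 : seq tree_point) (c : colouring) :
  colour_sum (s1 ++ s2) c = colour_sum s1 c + colour_sum s2 c.
Proof. by rewrite /colour_sum; case: ifP; rewrite ?addr0// big_cat. Qed.

Lemma branch_nbhs_trunc (p : branch) (m : nat) (x : tree_point) :
  branch_nbhs p m x -> forall n, (n <= m)%N -> trunc x n = mkseq p n.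
Proof.
move=> [->//|[k [r [-> mk _]]]] n nm /=.
by rewrite take_mkseq// (leq_trans nm).
Qed.

Definition indicator (A : pred tree_point) : colouring := fun x => nat_of_bool (A x).

Lemma admissible_indicator (A : pred tree_point) :
  (forall p, exists m, forall x, branch_nbhs p m x -> A x = A (inr p)) ->
  admissible (indicator A).
Proof.
by move=> h p; have [m mP] := h p; exists m => x /mP; rewrite /indicator => ->.
Qed.

Lemma admissible_cone (a : seq bool) : admissible (indicator (cone a)).
Proof.
apply: admissible_indicator => p; exists (size a) => x /branch_nbhs_trunc h.
by rewrite /cone h.
Qed.

Lemma admissible_single (q : seq bool * rat) :
  admissible (indicator (pred1 (inl q : tree_point))).
Proof.
apply: admissible_indicator => p; exists (size q.1).+1 => x [-> //|].
move=> [n [r [-> nq _]]] /=; apply/eqP => -[qE].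
by move: nq; rewrite -qE /= size_mkseq ltnn.
Qed.

Definition parity (h : colouring -> {poly bool}) (A : pred tree_point) : bool :=
  (h (indicator A))`_1.

Lemma parity_colour_sum (s : seq tree_point) (A : pred tree_point) :
  admissible (indicator A) -> parity (colour_sum s) A = odd (count A s).
Proof.
move=> AP; rewrite /parity coef_colour_sum//; congr odd; apply: eq_count => x.
by rewrite /indicator; case: (A x).
Qed.

(** * Extending the value function to the group *)

(** Only the parities of cones and of single pairs enter, so the walk is defined
    on families [h] of polynomials and not on words that represent them. *)
Fixpoint walk (h : colouring -> {poly bool}) (n : nat) : seq bool :=
  if n is n'.+1 then
    rcons (walk h n') (parity h (cone (rcons (walk h n') true)))
  else [::].

Definition walk_branch (h : colouring -> {poly bool}) : branch :=
  fun n => parity h (cone (rcons (walk h n) true)).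

Lemma walkE (h : colouring -> {poly bool}) (n : nat) :
  walk h n = mkseq (walk_branch h) n.
Proof. by elim: n => // n IH; rewrite mkseqS -IH. Qed.

Definition hit (h : colouring -> {poly bool}) (n : nat) (r : rat) : bool :=
  parity h (pred1 (inl (walk h n, r) : tree_point)).

Definition first_hits (h : colouring -> {poly bool}) : set (nat * rat) :=
  [set q | hit h q.1 q.2 /\ forall k r, (k < q.1)%N -> ~~ hit h k r].

Definition selected_value (h : colouring -> {poly bool}) : R :=
  if `[< first_hits h !=set0 >] then ratr (xget (0%N, 0) (first_hits h)).2
  else limit_value (walk_branch h).

Definition off_branch (p : branch) (n : nat) : seq bool :=
  rcons (mkseq p n) (~~ p n).

Lemma cone_off_branch_inj (p : branch) (x : tree_point) (m n : nat) :
  cone (off_branch p m) x -> cone (off_branch p n) x -> m = n.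
Proof.
suff lt k l : cone (off_branch p k) x -> cone (off_branch p l) x -> (l <= k)%N.
  by move=> hm hn; apply/eqP; rewrite eqn_leq !lt.
rewrite /cone !size_rcons !size_mkseq => /eqP xk /eqP xl.
rewrite leqNgt; apply/negP => kl.
have := take_trunc x (ltnW kl : (k.+1 <= l.+1)%N); rewrite xk xl /off_branch.
rewrite -cats1 takel_cat ?size_mkseq// take_mkseq// mkseqS => /eqP.
by rewrite eqseq_rcons eqxx /=; case: (p k).
Qed.

Lemma line_not_off_branch (p : branch) (n k : nat) (r : rat) :
  ~~ cone (off_branch p n) (inl (mkseq p k, r)).
Proof.
rewrite /cone size_rcons size_mkseq /=; have [nk|kn] := ltnP n k.
  by rewrite take_mkseq// mkseqS eqseq_rcons eqxx /=; case: (p n).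
apply/eqP => /(congr1 size); rewrite take_oversize ?size_mkseq//; last exact: leqW.
by rewrite size_rcons size_mkseq => kE; move: kn; rewrite kE ltnn.
Qed.

Lemma branch_nbhs_not_off_branch (p : branch) (m n : nat) (x : tree_point) :
  branch_nbhs p m x -> ~~ cone (off_branch p n) x.
Proof.
case=> [->|[k [r [-> _ _]]]]; last exact: line_not_off_branch.
rewrite /cone size_rcons size_mkseq /= mkseqS eqseq_rcons eqxx /=.
by case: (p n).
Qed.

(** The colouring that controls the walk along [p]: one colour for the
    neighbourhood of [p], one for each cone that leaves [p], and a separate
    colour for each remaining pair. *)
Definition guide (p : branch) (m : nat) : colouring := fun x =>
  if `[< branch_nbhs p m x >] then 0%N
  else if pselect (exists n, cone (off_branch p n) x) is left ex
    then (pickle (inl (xchoose ex) : nat + seq bool * rat)).+1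
  else if x is inl q then (pickle (inr q : nat + seq bool * rat)).+1
  else 0%N.

Lemma guide_off_branch (p : branch) (m n : nat) (x : tree_point) :
  (guide p m x == (pickle (inl n : nat + seq bool * rat)).+1) =
  cone (off_branch p n) x.
Proof.
rewrite /guide; case: asboolP => [tx|ntx].
  by rewrite (negbTE (branch_nbhs_not_off_branch n tx)).
case: pselect => [ex|nex]; last first.
  have -> : cone (off_branch p n) x = false by apply/negP => xn; apply: nex; exists n.
  case: x {ntx nex} => // q; rewrite eqSS; apply/eqP.
  by move/(pcan_inj pickleK).
rewrite eqSS (inj_eq (pcan_inj pickleK)).
have xex := xchooseP ex; apply/eqP/idP => [[<-]//|xn].
by rewrite (cone_off_branch_inj xex xn).
Qed.

Lemma guide_single (p : branch) (m n : nat) (r : rat) (x : tree_point) :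
  ~ branch_nbhs p m (inl (mkseq p n, r)) ->
  (guide p m x == (pickle (inr (mkseq p n, r) : nat + seq bool * rat)).+1) =
  (x == inl (mkseq p n, r)).
Proof.
move=> nt; apply/eqP/eqP => [|->].
  rewrite /guide; case: asboolP => // _; case: pselect => [ex|_].
    by move=> /succn_inj/(pcan_inj pickleK).
  by case: x => // q /succn_inj/(pcan_inj pickleK)[->].
rewrite /guide asboolF//; case: pselect => // ex; exfalso.
by have [k] := ex; apply/negP; exact: line_not_off_branch.
Qed.

(** A branch other than [p] lies, with a whole neighbourhood, in the cone that
    leaves [p] where the two branches separate. *)
Lemma admissible_guide (p : branch) (m : nat) : admissible (guide p m).
Proof.
move=> q; have [->|qp] := pselect (q = p).
  exists m => x tx; rewrite /guide !asboolT//; by left.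
have exq : exists n, q n != p n.
  apply: contrapT => h; apply: qp; apply/funext => n; apply: contrapT => /eqP qpn.
  by apply: h; exists n.
case: (ex_minnP exq) => n qpn minn; exists n.+1.
have onq x : branch_nbhs q n.+1 x -> cone (off_branch p n) x.
  move=> /branch_nbhs_trunc/(_ n.+1 (leqnn _)).
  rewrite /cone size_rcons size_mkseq => ->; rewrite mkseqS /off_branch.
  rewrite (_ : mkseq q n = mkseq p n).
    by rewrite eqseq_rcons eqxx /=; move: qpn; case: (q n); case: (p n).
  apply/eq_in_map => k; rewrite mem_iota => /= kn; apply/eqP.
  by apply: contraLR kn => /minn; rewrite -leqNgt.
move=> x /onq; rewrite -(guide_off_branch p m) => /eqP ->; apply/esym/eqP.
by rewrite guide_off_branch; apply: onq; left.
Qed.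

Lemma first_hits_neq0 (h : colouring -> {poly bool}) (n : nat) (r : rat) :
  hit h n r -> first_hits h !=set0.
Proof.
move=> hn; have ex : exists n, `[< exists r, hit h n r >].
  by exists n; apply/asboolP; exists r.
case: (ex_minnP ex) => k /asboolP[r' hk] mink; exists (k, r'); split=> // l r2 lk.
by apply: contraL lk => hl; rewrite -leqNgt; apply: mink; apply/asboolP; exists r2.
Qed.

Lemma even_line (s : seq tree_point) (a : seq bool) :
  (forall r, ~~ odd (count_mem (inl (a, r)) s)) -> ~~ odd (count (line a) s).
Proof.
move=> ev; apply/negP => /odd_count_ex[[[b r]|//] /= /eqP ->].
by apply/negP; exact: ev.
Qed.

Lemma hit_colour_sum (s : seq tree_point) (n : nat) (r : rat) :
  hit (colour_sum s) n r = odd (count_mem (inl (walk (colour_sum s) n, r)) s).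
Proof. by rewrite /hit parity_colour_sum//; exact: admissible_single. Qed.

Section Agreement.
Context (s s' : seq tree_point) (m : nat).
Let h := colour_sum s.
Let h' := colour_sum s'.
Let p := walk_branch h.
Context (agree_guide : h' (guide p m) = h (guide p m)).
Context (agree_total : parity h' (cone [::]) = parity h (cone [::])).

Let no_hits g n := forall k r, (k < n)%N -> ~~ hit g k r.

Lemma agree_off_branch (n : nat) :
  odd (count (cone (off_branch p n)) s') = odd (count (cone (off_branch p n)) s).
Proof.
have := congr1 (fun u : {poly bool} =>
  u`_((pickle (inl n : nat + seq bool * rat)).+1)) agree_guide.
rewrite /h /h' !coef_colour_sum; try exact: admissible_guide.
by under eq_count do rewrite guide_off_branch; under [in RHS]eq_count
  do rewrite guide_off_branch.
Qed.

Lemma agree_single (n : nat) (r : rat) : ~ branch_nbhs p m (inl (mkseq p n, r)) ->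
  odd (count_mem (inl (mkseq p n, r)) s') = odd (count_mem (inl (mkseq p n, r)) s).
Proof.
move=> nt; have := congr1 (fun u : {poly bool} =>
  u`_((pickle (inr (mkseq p n, r) : nat + seq bool * rat)).+1)) agree_guide.
rewrite /h /h' !coef_colour_sum; try exact: admissible_guide.
by under eq_count do rewrite guide_single//; under [in RHS]eq_count
  do rewrite guide_single//.
Qed.

(** The points above a node of [p] are those on the node, those above the next
    node of [p], and those in the cone that leaves [p] there. The first number
    is even in the absence of hits and the parity of the third is fixed by the
    colouring, so equality of the parities above nodes of [p] passes from each
    node to the next. *)
Lemma agree_walk (n : nat) : no_hits h n -> no_hits h' n ->
  odd (count (cone (mkseq p n)) s') = odd (count (cone (mkseq p n)) s) /\
  walk h' n = walk h n.
Proof.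
elim: n => [_ _|n IH nh nh'].
  by move: agree_total; rewrite !parity_colour_sum//; exact: admissible_cone.
have [||cE wE] := IH; first by move=> k r kn; apply: nh; exact: ltnW.
  by move=> k r kn; apply: nh'; exact: ltnW.
have even1 : ~~ odd (count (line (mkseq p n)) s).
  by apply: even_line => r; rewrite -walkE -hit_colour_sum nh.
have even2 : ~~ odd (count (line (mkseq p n)) s').
  by apply: even_line => r; rewrite -walkE -wE -hit_colour_sum nh'.
pose par t b := odd (count (cone (rcons (mkseq p n) b)) t).
have cSE b : par s' b = par s b.
  have : par s' true (+) par s' false = par s true (+) par s false.
    move: cE; rewrite (cone_count_split _ s) (cone_count_split _ s') !oddD.
    by rewrite (negbTE even1) (negbTE even2) !addFb.
  have : par s' (~~ p n) = par s (~~ p n) by exact: agree_off_branch.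
  case: (p n); case: b; move: (par s' true) (par s' false) => [] [];
  by move: (par s true) (par s false) => [] [].
split; first by rewrite mkseqS; exact: cSE.
rewrite /= wE !parity_colour_sum; try exact: admissible_cone.
by rewrite walkE -/p; congr rcons; exact: cSE.
Qed.

(** Below level [m] the colouring [guide p m] gives every pair on [p] a colour of
    its own, so the two walks meet the same pairs. *)
Lemma selected_value_before (n : nat) (r : rat) :
  first_hits h (n, r) -> (n < m)%N -> selected_value h' = selected_value h.
Proof.
move=> [/= hn nh] nm.
have sameh k r' : walk h' k = walk h k -> (k <= n)%N -> hit h' k r' = hit h k r'.
  move=> wE kn; rewrite !hit_colour_sum wE walkE -/p; apply: agree_single => -[//|].
  move=> [k' [r2 [[kE _] mk' _]]].
  have := congr1 size kE; rewrite !size_mkseq => kk'.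
  by move: mk'; rewrite -kk' leqNgt (leq_ltn_trans kn nm).
have nh' : no_hits h' n.
  move=> k; elim/ltn_ind: k => k IH r' kn; rewrite sameh ?nh//; last exact: ltnW.
  apply: (agree_walk _ _).2; first by move=> l r2 lk; apply: nh; exact: ltn_trans kn.
  by move=> l r2 lk; apply: IH => //; exact: ltn_trans kn.
have hE r' : hit h' n r' = hit h n r' by apply: sameh => //; exact: (agree_walk _ _).2.
suff fE : first_hits h' = first_hits h.
  rewrite /selected_value fE asboolT//; by exists (n, r).
have first g : hit g n r -> no_hits g n ->
    first_hits g = [set q | q.1 = n /\ hit g n q.2].
  move=> gn ng; apply/seteqP; split=> -[k r'] /= [gk gP]; last by rewrite gk.
  suff kn : k = n by rewrite -kn.
  have [lt|lt|//] := ltngtP k n; first by have := ng _ r' lt; rewrite gk.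
  by have := gP _ r lt; rewrite gn.
rewrite !first ?hE//; apply/seteqP; split=> q /=; rewrite hE//.
Qed.

(** The pairs on [p] outside the neighbourhood have even multiplicity in [s] and
    therefore in [s'], so a walk that stops does so inside the neighbourhood. *)
Lemma selected_value_limit : ~ (first_hits h !=set0) ->
  `|selected_value h' - selected_value h| < m.+1%:R^-1.
Proof.
move=> nofirst; have nh n r : ~~ hit h n r.
  by apply/negP => /first_hits_neq0.
rewrite {2}/selected_value asboolF// /selected_value.
case: asboolP => [ne|ne]; last first.
  rewrite (_ : walk_branch h' = p) ?subrr ?normr0 ?invr_gt0 ?ltr0n//.
  apply/funext => n; rewrite /p /walk_branch.
  have nh' k r : (k < n.+1)%N -> ~~ hit h' k r.
    by move=> _; apply/negP => /first_hits_neq0.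
  have [_] := agree_walk (fun k r _ => nh k r) nh'.
  by move=> /= /rcons_inj[].
case: xgetP => [[n r] _ [/= hn nh']|/(_ _)]; last first.
  by case: ne => q qP /(_ q).
have [_ wE] := agree_walk (fun k r _ => nh k r) nh'.
apply: contrapT => far; move: hn; rewrite hit_colour_sum wE walkE -/p agree_single.
  by rewrite /p -walkE -hit_colour_sum; apply/negP.
move=> [//|[k [r' [[kE <-] mk]]]].
exact: far.
Qed.

End Agreement.

(** The second colouring fixes the parity at the root, where the induction along
    the branch starts. The number [m] exceeds the level at which the walk stops,
    or else makes the neighbourhood of the limiting branch small. *)
Lemma selected_value_continuous (s : seq tree_point) (e : R) : 0 < e ->
  exists m : nat, forall s' : seq tree_point, let h := colour_sum s in
    let h' := colour_sum s' in
    h' (guide (walk_branch h) m) = h (guide (walk_branch h) m) ->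
    h' (indicator (cone [::])) = h (indicator (cone [::])) ->
    `|selected_value h' - selected_value h| < e.
Proof.
move=> e0; have [[[n r] nr]|no] := pselect (first_hits (colour_sum s) !=set0).
  exists n.+1 => s' h h' hg h0.
  rewrite (@selected_value_before _ _ n.+1 hg _ n r) ?subrr ?normr0//.
  exact: (congr1 (fun u : {poly bool} => u`_1) h0).
have [m me] := ltr_add_invr e0.
exists m => s' h h' hg h0; apply: lt_trans (selected_value_limit hg _ no) _.
  exact: (congr1 (fun u : {poly bool} => u`_1) h0).
by rewrite add0r in me.
Qed.

Lemma selected_value_single (q : seq bool * rat) :
  selected_value (colour_sum [:: inl q]) = ratr q.2.
Proof.
set h := colour_sum _; case: q @h => a r h.
have walk_h n : (n <= size a)%N -> walk h n = take n a.
  elim: n => [|n IH] na; first by rewrite take0.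
  rewrite /= IH; last exact: ltnW.
  rewrite parity_colour_sum; last exact: admissible_cone.
  rewrite /= addn0 oddb /cone size_rcons size_takel; last exact: ltnW.
  by rewrite /= (take_nth false na) eqseq_rcons eqxx eqb_id.
have hit_h n r' : hit h n r' = (n == size a) && (r' == r).
  rewrite hit_colour_sum /= addn0 oddb; apply/eqP/andP => [[aE ->]|[/eqP -> /eqP ->]].
    by rewrite aE walkE size_mkseq eqxx.
  by rewrite walk_h// take_size.
have ne : first_hits h !=set0.
  by apply: (@first_hits_neq0 _ (size a) r); rewrite hit_h !eqxx.
rewrite /selected_value asboolT//.
have [] := xgetPex (0%N, 0) ne; rewrite hit_h.
by move=> /andP[_ /eqP ->].
Qed.

(** * Diagonalisation *)

(** Let [E] consist of the reals below which the coded set does not stay: for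
    [t] in [E] it contains pairs [(p|n, r)] with [r >= t] for arbitrarily large
    [n]. Near [sup E] there are pairs in the set for arbitrarily large [n], while
    slightly above [sup E] all pairs with large [n] are outside. *)
Lemma splits_ex (p : branch) :
  (forall n (r : rat), r <= 0 -> p (pickle (mkseq p n, r))) ->
  (forall n (r : rat), 1 <= r -> ~~ p (pickle (mkseq p n, r))) ->
  exists t : R, splits p t.
Proof.
move=> pos neg.
pose E := [set t : R | forall m, exists n r,
  [/\ (m <= n)%N, t <= ratr r & p (pickle (mkseq p n, r))]].
have E0 : E 0 by move=> m; exists m, 0; rewrite rmorph0 lexx pos.
have supE : has_sup E.
  split; first by exists 0.
  exists 1 => t /(_ 0%N)[n [r [_ tr pr]]]; apply: le_trans tr _.
  rewrite -[1](rmorph1 (ratr : rat -> R)) ler_rat leNgt; apply/negP => /ltW r1.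
  by have := neg n r r1; rewrite pr.
exists (sup E) => m; set e := m.+1%:R^-1.
have e0 : 0 < e :> R by rewrite invr_gt0 ltr0n.
have [t Et tsup] : exists2 t, E t & sup E - e < t by exact: sup_adherent.
have [m' m'P] : exists m', forall n r, (m' <= n)%N -> sup E + e / 2 <= ratr r ->
    ~~ p (pickle (mkseq p n, r)).
  apply: contrapT => h; have : E (sup E + e / 2).
    move=> k; apply: contrapT => hk; apply: h; exists k => n r kn tr.
    by apply/negP => pr; apply: hk; exists n, r.
  move/(ub_le_sup supE.2); apply/negP; rewrite -ltNge ltrDl.
  by rewrite divr_gt0.
case.
  have [n [r [mn tr pr]]] := Et (maxn m m'); exists n, r.
  move: mn; rewrite geq_max => /andP[mn m'n]; split=> //.
  rewrite ltr_distl (lt_le_trans tsup tr) /=.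
  have : ratr r < sup E + e / 2.
    by rewrite ltNge; apply/negP => /(m'P n r m'n); rewrite pr.
  move/lt_le_trans; apply; rewrite lerD2l ler_pdivrMr// ler_peMr ?(ltW e0)//.
  by rewrite ler1n.
have /rat_in_itvoo[r] : sup E + e / 2 < sup E + e.
  by rewrite ltrD2l ltr_pdivrMr// ltr_pMr// ltr1n.
rewrite in_itv /= => /andP[r1 r2]; exists (maxn m m'), r; rewrite leq_maxl; split=> //.
  rewrite ltr_distl r2 andbT; apply: lt_trans r1.
  by rewrite ltrD2l (@lt_trans _ _ 0) ?oppr_lt0// divr_gt0.
by apply/negbTE/m'P; [exact: leq_maxr|exact: ltW].
Qed.

(** * The group and its closed subgroup *)

Lemma colour_sum_opp (s : seq tree_point) (c : colouring) :
  - colour_sum s c = colour_sum s c.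
Proof. by apply/polyP => i; rewrite coefN; case: (_`_i). Qed.

(** The first component ranges over an uncountable set of copies of the second;
    for sequences of bits Cantor's argument shows this at once. *)
Definition coordinate := ((nat -> bool) * colouring)%type.

(** The sequence [j] lists the countably many exceptional coordinates. *)
Definition almost_diagonal : {pred coordinate -> {poly bool}} := fun u =>
  `[< exists s (j : nat -> coordinate),
        forall i, ~ range j i -> u i = colour_sum s i.2 >].

Lemma almost_diagonal_zmod_closed : zmod_closed almost_diagonal.
Proof.
split.
  apply/asboolP; exists [::], (fun=> (fun=> false, fun=> 0%N)) => i _.
  by rewrite /colour_sum; case: ifP; rewrite ?big_nil.
move=> u v /asboolP[s [j us]] /asboolP[s' [j' vs']]; apply/asboolP.
exists (s ++ s'), (fun k => if odd k then j k./2 else j' k./2) => i ni.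
have nj : ~ range j i.
  by move=> [k _ ki]; apply: ni; exists k.*2.+1; rewrite //= odd_double uphalf_double.
have nj' : ~ range j' i.
  by move=> [k _ ki]; apply: ni; exists k.*2; rewrite //= odd_double doubleK.
by rewrite colour_sum_cat -(colour_sum_opp s') -us// -vs'.
Qed.

HB.instance Definition _ := GRing.isZmodClosed.Build _ almost_diagonal
  almost_diagonal_zmod_closed.

Definition diagonal_group := pointwise_group almost_diagonal.

Lemma diagonal_group_strongly_zero_dimensional : strongly_zero_dimensional R diagonal_group.
Proof.
apply: sigma_product_strongly_zero_dimensional.
  exact: (fun=> false, fun=> 0%N).
move=> j u uj; apply/asboolP; exists [::], j => i /uj ->.
by rewrite /colour_sum; case: ifP; rewrite ?big_nil.
Qed.

Definition diagonal : set diagonal_group :=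
  [set u | forall o o' c, val u (o, c) = val u (o', c)].

Lemma diagonal_zmod_closed : zmod_closed (mem diagonal).
Proof.
split; first by rewrite inE.
move=> u v; rewrite !inE => uD vD o o' c.
rewrite !raddfB /=; change (val u (o, c) - val v (o, c) = val u (o', c) - val v (o', c)).
by rewrite (uD o o') (vD o o').
Qed.

Lemma diagonal_closed : closed diagonal.
Proof.
move=> u clu o o' c.
have [|v [vD uv]] := clu [set v | agree_on [:: (o, c); (o', c)] u v].
  by exists [:: (o, c); (o', c)].
by rewrite !uv ?inE ?eqxx ?orbT//; exact: vD.
Qed.

Lemma diagonalE (u : diagonal_group) : diagonal u ->
  exists s, forall o c, val u (o, c) = colour_sum s c.
Proof.
move=> uD; have /asboolP[s [j us]] := valP u; exists s => o c.
(* Cantor's diagonal: the first component [o'] is missed by the sequence [j]. *)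
pose o' k := ~~ (j k).1 k.
rewrite (uD o o') us// => -[k _ /(congr1 fst)/(congr1 (@^~ k))] /=.
by rewrite /o'; case: (_ k).
Qed.

Definition diagonal_copy (s : seq tree_point) : coordinate -> {poly bool} :=
  fun i => colour_sum s i.2.

Lemma diagonal_copy_almost_diagonal (s : seq tree_point) :
  diagonal_copy s \in almost_diagonal.
Proof.
by apply/asboolP; exists s, (fun=> (fun=> false, fun=> 0%N)) => i.
Qed.

Definition embed (x : tree_point) : diagonal_group :=
  Sub (diagonal_copy [:: x]) (diagonal_copy_almost_diagonal [:: x]).

Lemma embed_diagonal (x : tree_point) : embed x \in diagonal.
Proof. by rewrite inE => o o' c; rewrite !SubK. Qed.

Definition generator (x : tree_point) : set_type diagonal :=
  SigSub (embed_diagonal x).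

Definition diagonal_value (u : set_type diagonal) : R :=
  selected_value (fun c => val (set_val u) (fun=> false, c)).

Lemma diagonal_value_continuous : continuous diagonal_value.
Proof.
move=> u; have Fu : Filter (nbhs u) by exact: nbhs_filter.
apply/(@cvgrPdist_lt _ _ _ _ Fu) => e e0.
have [s us] := diagonalE (set_valP u).
have [m me] := @selected_value_continuous s e e0.
have valE (w : set_type diagonal) t :
    (forall o c, val (set_val w) (o, c) = colour_sum t c) ->
    diagonal_value w = selected_value (colour_sum t).
  by move=> wt; congr selected_value; apply/funext => c; exact: wt.
pose l : seq coordinate := [seq (fun=> false, c) |
  c <- [:: guide (walk_branch (colour_sum s)) m; indicator (cone [::])]].
have near_u : nbhs (set_val u) [set w | agree_on l (set_val u) w] by exists l.
have cont_val : continuous (set_val : set_type diagonal -> diagonal_group).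
  exact: initial_continuous.
apply: (@filterS _ _ Fu _ _ _ (cont_val u _ near_u)) => w uw.
have [t wt] := diagonalE (set_valP w).
rewrite (valE u s)// (valE w t)// distrC; apply: me.
  by rewrite -(wt (fun=> false)) -(us (fun=> false)); apply/esym/uw; rewrite inE eqxx.
by rewrite -(wt (fun=> false)) -(us (fun=> false)); apply/esym/uw; rewrite !inE eqxx orbT.
Qed.

(** Only finitely many colourings restrict a neighbourhood of the generator [p],
    and each of them is constant near [p]. *)
Lemma generator_nbhs (W : set (set_type diagonal)) (p : branch) :
  open W -> W (generator (inr p)) ->
  exists m, forall x, branch_nbhs p m x -> W (generator x).
Proof.
case=> O oO WE; rewrite -WE => Op.
have [l lO] : nbhs (embed (inr p)) O by exact: open_nbhs_nbhs.
have [m mP] : exists m, forall i, i \in l -> forall x, branch_nbhs p m x ->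
    colour_sum [:: inr p] i.2 = colour_sum [:: x] i.2.
  elim: l {lO} => [|i l [m mP]]; first by exists 0%N.
  have branch_nbhs_le m1 m2 x : (m1 <= m2)%N -> branch_nbhs p m2 x -> branch_nbhs p m1 x.
    move=> m12 [->|[n [r [-> mn h]]]]; [by left|right].
    exists n, r; split=> //; first exact: leq_trans mn.
    by apply: lt_le_trans h _; rewrite lef_pV2 ?posrE ?ltr0n// ler_nat.
  have [ci|nci] := pselect (admissible i.2); last first.
    exists m => k; rewrite inE => /predU1P[-> x _|/mP//].
    by rewrite /colour_sum asboolF.
  have [m' m'P] := ci p; exists (maxn m m') => k.
  rewrite inE => /predU1P[-> x /(branch_nbhs_le m')|kl x /(branch_nbhs_le m)].
    move=> /(_ (leq_maxr _ _))/m'P xE.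
    by rewrite /colour_sum asboolT// !big_seq1 xE.
  by move=> /(_ (leq_maxl _ _)); exact: mP.
exists m => x tx; apply: lO => i il; rewrite !SubK; exact: mP.
Qed.

(** The pairs whose generators lie in the clopen set [W] are coded by a branch
    [p]; the generator [p] then lies in the closure of both [W] and its
    complement. *)
Lemma diagonal_not_dim0_le0 : ~ dim0_le R (set_type diagonal) 0.
Proof.
move/clopen_separation_of_dim0_le0 => /(_ _ diagonal_value_continuous).
move=> [W [oW oWC W0 W1]].
have valE q : diagonal_value (generator (inl q)) = ratr q.2.
  by rewrite -selected_value_single; congr selected_value; apply/funext => c; rewrite SubK.
pose p : branch := fun k => if unpickle k is Some q then
  `[< W (generator (inl q)) >] else false.
have pE q : p (pickle q) = `[< W (generator (inl q)) >] by rewrite /p pickleK.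
have pt : splits p (limit_value p).
  apply: (@xgetPex _ 0 [set t | splits p t]); apply: splits_ex => n r r0; rewrite pE.
    by apply/asboolP/W0; rewrite /= valE lerq0.
  by apply/asboolP/W1; rewrite /= valE -[1](rmorph1 (ratr : rat -> R)) ler_rat.
have contra (V : set (set_type diagonal)) b : open V -> V (generator (inr p)) ->
    (forall q, p (pickle q) = b -> ~ V (generator (inl q))) -> False.
  move=> oV Vp Vb; have [m mV] := generator_nbhs oV Vp.
  have [n [r [mn rt prb]]] := pt m b; apply: (Vb _ prb); apply: mV.
  by right; exists n, r.
have [Wp|Wp] := pselect (W (generator (inr p))).
  by apply: (contra W false) => // q; rewrite pE => /asboolPn.
by apply: (contra (~` W) true) => // q; rewrite pE => /asboolP Wq; exact.
Qed.

End Construction.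

Theorem theorem1 (R : realType) :
  exists (G : topologicalZmodType) (H : set G),
    [/\ strongly_zero_dimensional R G,
        zmod_closed (mem H),
        closed H &
        (0%:E < dim0 R (set_type H))%E].
Proof.
exists (diagonal_group R), (@diagonal R); split.
- exact: diagonal_group_strongly_zero_dimensional.
- exact: diagonal_zmod_closed.
- exact: diagonal_closed.
- by rewrite ltNge; apply/negP => /dim0_leP => /(_ isT); exact: diagonal_not_dim0_le0.
Qed.
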